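(* Any origami deformation necessarily changes the topology of a pillow box. That is, if $M$ is a pillow box given by fundamental data $(b,\zeta(s),\,0\le s\le L)$ and $\{M^t\}_{t\in[0,1]}$ is any origami deformation from $M=M^0$ to its double rectangle, then there exists $t\in(0,1)$ such that $M^t$ is not homeomorphic to $M$.
   Context: **Fundamental data.** A pair $(b,\zeta)$, where $b>0$ and $\zeta:[0,L]\to\mathbb{R}$ ($L>0$) is a smooth function with $1-2\zeta'(s)^2>0$ on $[0,L]$, $\zeta(0)=\zeta(L)=0$, and $0<\zeta(s)<b$, $\zeta''(s)<0$ for $s\in(0,L)$. Put $U=\{(s,v): 0\le s\le L,\ \zeta(s)-b\le v\le\zeta(s)\}$, $U_+=\{(s,v)\in U: v\ge0\}$, $U_-=\{(s,v)\in U: v\le0\}$, $\xi=(0,0,-1)$, $\check\xi=(0,-1,0)$. **Pillow box and origami-parametrization.** Let $\boldsymbol{c}(s)=\left(\int_0^s\sqrt{1-2\zeta'(w)^2}\,dw,\ \zeta(s),\ \zeta(s)\right)$. The origami-parametrization is $X:U\to\mathbb{R}^3$ with $X(s,v)=\boldsymbol{c}(s)+v\xi$ on $U_+$ and $X(s,v)=\boldsymbol{c}(s)+v\check\xi$ on $U_-$. The quarter domain is $P=X(U)$, and the pillow box is $M=P\cup\rho_V(P)\cup\rho_H(P)\cup\rho_H\circ\rho_V(P)$ (with the subspace topology of $\mathbb{R}^3$; it is homeomorphic to the sphere $S^2$), where $\rho_V(x,y,z)=(x,2b-y,z)$ and $\rho_H(x,y,z)=(x,y,-z)$. **Developing map and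 double rectangle.** $Y:U\to\mathbb{R}^3$, $Y(s,v)=\gamma(s)+v\check\xi$, where $\gamma(s)=\left(\int_0^s\sqrt{1-\zeta'(w)^2}\,dw,\ \zeta(s),\ 0\right)$. The image $Y(U)$ is a rectangle $[0,2a]\times[0,b]\times\{0\}$; the double rectangle is obtained from two copies of the rectangle $R=Y(U)\cup\rho_V(Y(U))$ by identifying corresponding points of their four sides. Both $X$ (on each of $U_\pm$) and $Y$ have first fundamental form $g=ds^2-2\zeta'(s)\,ds\,dv+dv^2$. **Origami-maps.** Let $\boldsymbol{c}:[0,L]\to\mathbb{R}^3$ be a continuous injective curve which on $(0,L)$ is smooth, parametrized by arc length and of positive curvature, with Frenet frame $T=\boldsymbol c'$, $N=T'/\|T'\|$, $B=T\times N$. A developable surface along $\boldsymbol{c}$ with first angular function $\alpha$ and second angular function $\beta$ is a ruled surface $(s,v)\mapsto\boldsymbol{c}(s)+v\,\eta(s)$ of zero Gaussian curvature, an embedding on $\{(s,v)\in U:0<s<L\}$, with $\eta=\cos\beta\,T+\sin\beta(\cos\alpha\,N+\sin\alpha\,B)$, where $\alpha,\beta$ are smooth functions on $(0,L)$, $|\alpha|<\pi/2$, $0<\beta<\pi$. A continuous map $U\to\mathbb{R}^3$ is an origami-map with crease $\boldsymbol{c}$ if it equals $p$ on $U_+$ and $q$ on $U_-$, where $p$ and $q$ are developable surfaces along the same curve $\boldsymbol{c}$ whose first angular functions are $\alpha$ and $-\alpha$ respectively (their second angular functions may a priori differ). Regularity and angle conditions, and equality of first fundamental forms, are required for $s\in(0,L)$.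 **Quarter origami deformation from $X$ to $Y$.** A continuous $1$-parameter family $\{X^t:U\to\mathbb{R}^3\}_{t\in[0,1]}$ of origami-maps (i.e. $(t,s,v)\mapsto X^t(s,v)$ is continuous) of the form $X^t(s,v)=p^t(s,v)=\boldsymbol{c}^t(s)+v\,\xi^t(s)$ on $U_+$ and $X^t(s,v)=q^t(s,v)=\boldsymbol{c}^t(s)+v\,\check\xi$ on $U_-$, such that (1) $X^0=X$ and $X^1=Y$; (2) for each $t\in[0,1]$ the first fundamental forms of $p^t$ and $q^t$ coincide with $g$ on $U_+$ and $U_-$ respectively; (3) the endpoints $\boldsymbol{c}^t(0)$ and $\boldsymbol{c}^t(L)$ lie on the $x$-axis for each $t\in[0,1]$. **Origami deformation.** Given a quarter origami deformation $\{X^t\}_{t\in[0,1]}$ from $X$ to $Y$, set $P^t=X^t(U)$ and $M^t=P^t\cup\rho_V(P^t)\cup\rho_H(P^t)\cup\rho_H\circ\rho_V(P^t)\subset\mathbb{R}^3$ (subspace topology). The family $\{M^t\}_{t\in[0,1]}$ is called an origami deformation from the pillow box $M$ to its double rectangle. *)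

(* Defs.v *)
From HB Require Import structures.
From mathcomp Require Import all_boot all_order all_algebra.
From mathcomp Require Import all_classical all_reals all_analysis.

Set Implicit Arguments.
Unset Strict Implicit.
Unset Printing Implicit Defensive.

Import Order.TTheory GRing.Theory Num.Theory.
Import numFieldNormedType.Exports.

Local Open Scope classical_set_scope.
Local Open Scope ring_scope.

(* [`|u|] on ['rV[R]_3] is the sup norm, hence the explicit Euclidean
   structure below; both norms induce the same topology. *)
Section Space.
Variable R : realType.
Implicit Types u v : 'rV[R]_3.

Definition vec3 (x y z : R) : 'rV[R]_3 := \row_(j < 3) nth 0 [:: x; y; z] j.

Definition dot u v : R := \sum_(i < 3) u 0 i * v 0 i.

Definition enorm u : R := Num.sqrt (dot u u).

Definition cross u v : 'rV[R]_3 :=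
  vec3 (u 0 1 * v 0 2 - u 0 2 * v 0 1)
       (u 0 2 * v 0 0 - u 0 0 * v 0 2)
       (u 0 0 * v 0 1 - u 0 1 * v 0 0).

Definition on_x_axis u : Prop := u 0 1 = 0 /\ u 0 2 = 0.

End Space.

Section Topology.
Variables S T : topologicalType.

(* Subsets carry the subspace topology; values of the witnesses outside the
   given sets are irrelevant. *)
Definition homeomorphism_on (A : set S) (B : set T) (f : S -> T) : Prop :=
  [/\ {within A, continuous f}, set_bij A B f &
      exists g : T -> S,
        {within B, continuous g} /\ (forall x, A x -> g (f x) = x)].

Definition homeomorphic (A : set S) (B : set T) : Prop :=
  exists f : S -> T, homeomorphism_on A B f.

End Topology.

Section Smoothness.
Variables (R : realType) (V : normedModType R).

(* A function on a subset [A] of the line is smooth when it is (the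
   restriction of) a C^infinity function on an open set containing [A]. For
   [A = [0, L]] the total function [f] stands for such an extension; its
   derivatives on [A] are the (at the end points, one-sided) derivatives of
   the restriction. *)
Definition smooth_on (A : set R) (f : R -> V) : Prop :=
  exists O : set R, [/\ open O, A `<=` O &
    forall n x, O x -> derivable (derive1n n f) x 1].

End Smoothness.

Section Surfaces.
Variable R : realType.
Implicit Types (F : R * R -> 'rV[R]_3) (x : R * R).

Definition pd_s F x : 'rV[R]_3 := 'D_((1, 0) : R * R) F x.
Definition pd_v F x : 'rV[R]_3 := 'D_((0, 1) : R * R) F x.

Definition first_formE F x : R := dot (pd_s F x) (pd_s F x).
Definition first_formF F x : R := dot (pd_s F x) (pd_v F x).
Definition first_formG F x : R := dot (pd_v F x) (pd_v F x).

Definition unit_normal F x : 'rV[R]_3 :=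
  let n := cross (pd_s F x) (pd_v F x) in (enorm n)^-1 *: n.

Definition gauss_curvature F x : R :=
  let n := unit_normal F x in
  (dot (pd_s (pd_s F) x) n * dot (pd_v (pd_v F) x) n
     - dot (pd_v (pd_s F) x) n ^+ 2)
  / (first_formE F x * first_formG F x - first_formF F x ^+ 2).

(* Smoothness of [F] is not part of this definition: it is only applied to
   ruled surfaces with smooth directrix and ruling. *)
Definition embedding_on (D : set (R * R)) F : Prop :=
  homeomorphism_on D (F @` D) F /\
  (forall x, D x -> cross (pd_s F x) (pd_v F x) != 0).

Definition ruled (c eta : R -> 'rV[R]_3) : R * R -> 'rV[R]_3 :=
  fun x => c x.1 + x.2 *: eta x.1.

End Surfaces.

Section Curves.
Variables (R : realType) (c : R -> 'rV[R]_3).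

Definition frenetT (s : R) : 'rV[R]_3 := derive1 c s.
Definition curvature (s : R) : R := enorm (derive1 frenetT s).
Definition frenetN (s : R) : 'rV[R]_3 := (curvature s)^-1 *: derive1 frenetT s.
Definition frenetB (s : R) : 'rV[R]_3 := cross (frenetT s) (frenetN s).

End Curves.

Section PillowBox.
Variable R : realType.

Definition fundamental_data (b L : R) (zeta : R -> R) : Prop :=
  [/\ 0 < b, 0 < L, smooth_on `[0, L] zeta &
   [/\ (forall s : R, 0 <= s <= L -> 0 < 1 - 2 * (derive1 zeta s) ^+ 2),
       zeta 0 = 0, zeta L = 0,
       (forall s : R, 0 < s < L -> 0 < zeta s < b) &
       (forall s : R, 0 < s < L -> derive1n 2 zeta s < 0)]].

Section Domain.
Variables (b L : R) (zeta : R -> R).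

Definition domU : set (R * R) :=
  [set x | 0 <= x.1 <= L /\ zeta x.1 - b <= x.2 <= zeta x.1].
Definition domUplus : set (R * R) := [set x | domU x /\ 0 <= x.2].
Definition domUminus : set (R * R) := [set x | domU x /\ x.2 <= 0].
Definition domUint : set (R * R) := [set x | domU x /\ 0 < x.1 < L].

Definition xi0 : 'rV[R]_3 := vec3 0 0 (-1).
Definition xi_check : 'rV[R]_3 := vec3 0 (-1) 0.

Definition pillow_curve (s : R) : 'rV[R]_3 :=
  vec3 (\int[lebesgue_measure]_(w in `[0, s])
          Num.sqrt (1 - 2 * (derive1 zeta w) ^+ 2))
       (zeta s) (zeta s).

Definition origami_param (x : R * R) : 'rV[R]_3 :=
  if 0 <= x.2 then pillow_curve x.1 + x.2 *: xi0
  else pillow_curve x.1 + x.2 *: xi_check.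

Definition developing_curve (s : R) : 'rV[R]_3 :=
  vec3 (\int[lebesgue_measure]_(w in `[0, s])
          Num.sqrt (1 - (derive1 zeta w) ^+ 2))
       (zeta s) 0.

Definition developing_map (x : R * R) : 'rV[R]_3 :=
  developing_curve x.1 + x.2 *: xi_check.

Definition rhoV (u : 'rV[R]_3) : 'rV[R]_3 :=
  vec3 (u 0 0) (2 * b - u 0 1) (u 0 2).
Definition rhoH (u : 'rV[R]_3) : 'rV[R]_3 :=
  vec3 (u 0 0) (u 0 1) (- u 0 2).

Definition reflected_union (P : set 'rV[R]_3) : set 'rV[R]_3 :=
  P `|` rhoV @` P `|` rhoH @` P `|` (rhoH \o rhoV) @` P.

Definition pillow_box : set 'rV[R]_3 :=
  reflected_union (origami_param @` domU).

Definition first_form_is_g (D : set (R * R)) (F : R * R -> 'rV[R]_3) : Prop :=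
  forall x, D x -> 0 < x.1 < L ->
    [/\ first_formE F x = 1, first_formF F x = - derive1 zeta x.1 & first_formG F x = 1].

Definition crease_curve (c : R -> 'rV[R]_3) : Prop :=
  [/\ {within `[0, L], continuous c},
      {in `[0, L] &, injective c},
      smooth_on `]0, L[ c,
      (forall s : R, 0 < s < L -> enorm (derive1 c s) = 1) &
      (forall s : R, 0 < s < L -> 0 < curvature c s)].

Definition developable_along (c eta : R -> 'rV[R]_3) (alpha beta : R -> R)
    : Prop :=
  [/\ smooth_on `]0, L[ alpha /\ smooth_on `]0, L[ beta,
      (forall s : R, 0 < s < L -> `|alpha s| < pi / 2 /\ 0 < beta s < pi),
      (forall s : R, 0 < s < L ->
         eta s = cos (beta s) *: frenetT c s
           + sin (beta s) *: (cos (alpha s) *: frenetN c s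
                              + sin (alpha s) *: frenetB c s)),
      (forall x, domUint x -> gauss_curvature (ruled c eta) x = 0) &
      embedding_on domUint (ruled c eta)].

(* [F] is an origami-map with crease [c] whose two sheets have rulings [eta]
   (on [domUplus]) and [eta'] (on [domUminus]). *)
Definition origami_map (F : R * R -> 'rV[R]_3) (c eta eta' : R -> 'rV[R]_3)
    : Prop :=
  [/\ {within domU, continuous F},
      crease_curve c,
      (forall x, domUplus x -> F x = ruled c eta x),
      (forall x, domUminus x -> F x = ruled c eta' x) &
      exists alpha beta beta' : R -> R,
        developable_along c eta alpha beta /\
        developable_along c eta' (fun s => - alpha s) beta'].

Definition quarter_origami_deformation (X : R -> R * R -> 'rV[R]_3) : Prop :=
  {within [set z : R * (R * R) | 0 <= z.1 <= 1 /\ domU z.2],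
     continuous (fun z => X z.1 z.2)} /\
  exists c xi : R -> R -> 'rV[R]_3,
   [/\ (forall t : R, 0 <= t <= 1 ->
          origami_map (X t) (c t) (xi t) (fun=> xi_check)),
       (forall x, domU x -> X 0 x = origami_param x),
       (forall x, domU x -> X 1 x = developing_map x),
       (forall t : R, 0 <= t <= 1 ->
          first_form_is_g domUplus (ruled (c t) (xi t)) /\
          first_form_is_g domUminus (ruled (c t) (fun=> xi_check))) &
       (forall t : R, 0 <= t <= 1 ->
          on_x_axis (c t 0) /\ on_x_axis (c t L))].

(* The target "double rectangle" is encoded by [X 1 = developing_map]. *)
Definition origami_deformation (M : R -> set 'rV[R]_3) : Prop :=
  exists X : R -> R * R -> 'rV[R]_3,
    quarter_origami_deformation X /\
    (forall t : R, 0 <= t <= 1 -> M t = reflected_union (X t @` domU)).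

End Domain.
End PillowBox.

(* Main.v *)
(* The first fundamental form forces every crease to have height [c_y = zeta]
   and the upper ruling to be a constant unit vector [eta] orthogonal to the
   x-axis. Along the deformation [eta_y] goes from [0] to [-1]; at a parameter
   with [eta_y = -1/2], the upper sheet crosses the plane [z = 0] transversally,
   and so meets its mirror image under [rhoH]: the surface contains
   triod x interval. The pillow box is locally planar, and triod x interval
   does not embed in the plane: in a triod two points can be interchanged by
   moving them along a loop of pairs of distinct points, which the extra
   interval makes contractible; the difference of the images of the two points
   would then be a nowhere zero planar map on a disc that is odd on the
   boundary. *)

Require Import Defs.
From mathcomp Require Import all_boot all_order all_algebra.
From mathcomp Require Import all_classical all_reals all_analysis.
From mathcomp Require Import ring lra.

Import Order.TTheory GRing.Theory Num.Theory.
Import numFieldNormedType.Exports.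

Local Open Scope classical_set_scope.
Local Open Scope ring_scope.

Set Implicit Arguments.
Unset Strict Implicit.

(** * Odd maps of the circle and planar embeddings of a triod strip *)

Lemma continuous_pairfun (S T U V : topologicalType) (h : T * U -> V)
    (f : S -> T) (g : S -> U) (x : S) :
  {for x, continuous f} -> {for x, continuous g} ->
  {for (f x, g x), continuous h} ->
  {for x, continuous (fun y => h (f y, g y))}.
Proof. by move=> cf cg; exact: (cvg_comp _ h (cvg_pair cf cg)). Qed.

Section Planar.
Variable R : realType.

(** The number [phi] is one value of the angle from [(a, b)] to [(p, q)], lengths being
    disregarded. *)
Definition parallel_rot (phi a b p q : R) : Prop :=
  exists2 r, 0 < r & p = r * (cos phi * a - sin phi * b) /\
                     q = r * (sin phi * a + cos phi * b).

(** A positive inner product keeps the angle from [(p, q)] to [(p', q')] strictly within a right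
    angle, where it is the arctangent of cross product over inner product. *)
Lemma parallel_rot_step (phi a b p q p' q' : R) :
  parallel_rot phi a b p q -> 0 < p * p' + q * q' ->
  parallel_rot (phi + atan ((p * q' - q * p') / (p * p' + q * q'))) a b p' q'.
Proof.
move=> [r r0 [pE qE]] dt0.
set dt := p * p' + q * q' in dt0 *; set cr := p * q' - q * p'.
set h := cr / dt.
have m0 : 0 < p ^+ 2 + q ^+ 2.
  rewrite lt_neqAle addr_ge0 ?sqr_ge0// andbT; apply/eqP => /esym/eqP.
  rewrite paddr_eq0 ?sqr_ge0// !sqrf_eq0 => /andP[/eqP p0 /eqP q0].
  by move: dt0; rewrite /dt p0 q0 !mul0r addr0 ltxx.
have k0 : 0 < cos (atan h).
  by apply: cos_gt0_pihalf; rewrite atan_gtNpi2 atan_ltpi2.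
have sE : sin (atan h) = h * cos (atan h).
  by rewrite -{2}(atanK h) /tan divfK// gt_eqF.
have crE : cr = h * dt by rewrite divfK// gt_eqF.
(* Decomposition of [(p', q')] along the orthogonal vectors [(p, q)] and [(- q, p)], cleared of
   denominators. *)
have p'E : p' * (p ^+ 2 + q ^+ 2) = dt * p - cr * q by rewrite /dt /cr; ring.
have q'E : q' * (p ^+ 2 + q ^+ 2) = dt * q + cr * p by rewrite /dt /cr; ring.
exists (r * dt / ((p ^+ 2 + q ^+ 2) * cos (atan h))).
  by rewrite divr_gt0// mulr_gt0.
have mn : p ^+ 2 + q ^+ 2 != 0 by rewrite gt_eqF.
have kn : cos (atan h) != 0 by rewrite gt_eqF.
rewrite cosD sinD sE; split.
  apply: (mulIf mn); rewrite p'E crE.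
  have -> : dt * p - h * dt * q = dt * (p - h * q) by ring.
  clearbody h dt; move: (p ^+ 2 + q ^+ 2) mn => m mn; rewrite pE qE.
  by field; rewrite mn kn.
apply: (mulIf mn); rewrite q'E crE.
have -> : dt * q + h * dt * p = dt * (q + h * p) by ring.
clearbody h dt; move: (p ^+ 2 + q ^+ 2) mn => m mn; rewrite pE qE.
by field; rewrite mn kn.
Qed.

(** Total turning along the vectors [(p k, q k)]: a discrete lift of the argument, continuous in the
    vectors as long as consecutive ones have positive inner product. *)
Fixpoint phase (p q : nat -> R) (k : nat) : R :=
  if k is k'.+1 then
    phase p q k' + atan ((p k' * q k - q k' * p k) / (p k' * p k + q k' * q k))
  else 0.

Lemma phaseP (p q : nat -> R) (n : nat) :
  p 0%N != 0 \/ q 0%N != 0 ->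
  (forall k, (k < n)%N -> 0 < p k * p k.+1 + q k * q k.+1) ->
  forall k, (k <= n)%N -> parallel_rot (phase p q k) (p 0%N) (q 0%N) (p k) (q k).
Proof.
move=> nz dt0; elim=> [|k IH] kn.
  by exists 1; rewrite // /= cos0 sin0; split; ring.
by apply: parallel_rot_step; [exact/IH/ltnW | exact: dt0].
Qed.

Lemma phase_cvg (p q : R -> nat -> R) (n : nat) (x : R) :
  (forall k, {for x, continuous (p ^~ k)}) ->
  (forall k, {for x, continuous (q ^~ k)}) ->
  (forall k, (k < n)%N -> 0 < p x k * p x k.+1 + q x k * q x k.+1) ->
  forall k, (k <= n)%N ->
  {for x, continuous (fun y => phase (p y) (q y) k)}.
Proof.
move=> cp cq dt0; elim=> [|k IH] kn; first by move=> /=; exact: cvg_cst.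
rewrite /=; apply: cvgD; first exact/IH/ltnW.
apply: (@continuous_comp _ _ _
  (fun y => (p y k * q y k.+1 - q y k * p y k.+1)
            / (p y k * p y k.+1 + q y k * q y k.+1)) atan); last exact: continuous_atan.
apply: cvgM.
  by apply: cvgB; apply: cvgM; [exact: cp|exact: cq|exact: cq|exact: cp].
apply: cvgV; first by rewrite gt_eqF// dt0.
by apply: cvgD; apply: cvgM; [exact: cp|exact: cp|exact: cq|exact: cq].
Qed.

(* Borsuk-Ulam for the disc, in polar coordinates [(rho, theta)]. *)
Lemma no_odd_planar_map (G1 G2 : R * R -> R) :
  continuous G1 -> continuous G2 ->
  (forall z, G1 z != 0 \/ G2 z != 0) ->
  (forall th, G1 (0, th) = G1 (0, 0) /\ G2 (0, th) = G2 (0, 0)) ->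
  (forall rho th, G1 (rho, th + pi *+ 2) = G1 (rho, th) /\
                  G2 (rho, th + pi *+ 2) = G2 (rho, th)) ->
  (forall th, G1 (1, th + pi) = - G1 (1, th) /\
              G2 (1, th + pi) = - G2 (1, th)) ->
  False.
Proof.
move=> c1 c2 nz G0 per odd.
(* Compactness gives a radial step [1/n] so short that consecutive values of [(G1, G2)] along any
   radius have positive inner product. *)
have [n n0 dtP] : exists2 n : nat, (0 < n)%N &
    forall rho th : R, 0 <= rho <= 1 -> 0 <= th <= pi *+ 2 ->
    0 < G1 (rho, th) * G1 (rho + n%:R^-1, th)
        + G2 (rho, th) * G2 (rho + n%:R^-1, th).
  have K : compact (`[0, 1]%classic `*` `[0, pi *+ 2]%classic : set (R * R)).
    by apply: compact_setX; exact: segment_compact.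
  have Finf : Filter (\oo : set_system nat) by exact: eventually_filter.
  have [|N _ /(_ N (leqnn N)) NP] :=
    (iffLR (compact_near_coveringP _) K) nat \oo
    (fun n z => 0 < G1 z * G1 (z.1 + n.+1%:R^-1, z.2)
                    + G2 z * G2 (z.1 + n.+1%:R^-1, z.2)) Finf.
    move=> z Kz.
    pose D (y : (R * R) * R) := G1 y.1 * G1 (y.1.1 + y.2, y.1.2)
                    + G2 y.1 * G2 (y.1.1 + y.2, y.1.2).
    have cD (g : R * R -> R) : continuous g ->
        continuous (fun y : (R * R) * R => g y.1 * g (y.1.1 + y.2, y.1.2)).
      move=> cg y; apply: cvgM.
        by apply: (@continuous_comp _ _ _ fst g); [exact: cvg_fst|exact: cg].
      apply: continuous_pairfun; last exact: cg.
        apply: cvgD; last exact: cvg_snd.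
        by apply: (@continuous_comp _ _ _ fst fst); exact: cvg_fst.
      by apply: (@continuous_comp _ _ _ fst snd); [exact: cvg_fst|exact: cvg_snd].
    (* At step length 0 the inner product is the squared length of a nonzero vector; by continuity
       it stays positive nearby. *)
    have : D (z, 0) > 0.
      rewrite /D /= addr0 -surjective_pairing -!expr2.
      rewrite lt_neqAle addr_ge0 ?sqr_ge0// andbT eq_sym paddr_eq0 ?sqr_ge0//.
      by rewrite !sqrf_eq0 negb_and; apply/orP; exact: nz.
    have cDz : {for (z, 0), continuous D} by apply: cvgD; exact: cD.
    move=> Dz.
    have : \forall y \near (z, 0 : R), 0 < D y.
      by have /= := cDz _ (lt_nbhsr Dz).
    case=> -[/= U V] [Uz V0] UV.
    exists (U, [set n | V n.+1%:R^-1]) => /=.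
      split=> //; exact: (@cvg_harmonic R _ V0).
    by move=> [z' m] /= [Uz' Vm]; exact: (UV (z', _)).
  exists N.+1 => // rho th rho01 th02.
  by apply: (NP (rho, th)); split; rewrite /= in_itv.
have nR : (n%:R : R) != 0 by rewrite pnatr_eq0 -lt0n.
pose p th k := G1 (k%:R / n%:R, th); pose q th k := G2 (k%:R / n%:R, th).
(* Turning of [(G1, G2)] along the radius of angle [th], measured from its value at the centre,
   which is the same vector for every [th]. *)
pose phi th := phase (p th) (q th) n.
have dt0 th k : 0 <= th <= pi *+ 2 -> (k < n)%N ->
    0 < p th k * p th k.+1 + q th k * q th k.+1.
  move=> th02 kn.
  have E : k.+1%:R / n%:R = k%:R / n%:R + n%:R^-1 :> R.
    by rewrite -natr1 mulrDl mul1r.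
  rewrite /p /q E; apply: dtP => //; rewrite divr_ge0// ler_pdivrMr ?mul1r ?ltr0n//.
  by rewrite ler_nat ltnW.
have pi2 : 0 <= pi *+ 2 :> R by rewrite mulrn_wge0// pi_ge0.
have rot th : 0 <= th <= pi *+ 2 ->
    parallel_rot (phi th) (G1 (0, 0)) (G2 (0, 0)) (G1 (1, th)) (G2 (1, th)).
  move=> th02.
  have nz0 : p th 0%N != 0 \/ q th 0%N != 0 by exact: nz.
  have := phaseP nz0 (fun k => dt0 th k th02) (leqnn n).
  by rewrite /p /q divff// mul0r (G0 th).1 (G0 th).2.
have cphi th : 0 <= th <= pi *+ 2 -> {for th, continuous phi}.
  move=> th02; apply: phase_cvg (leqnn n).
  - move=> k; apply: continuous_pairfun; [exact: cvg_cst|exact: cvg_id|].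
    exact: c1.
  - move=> k; apply: continuous_pairfun; [exact: cvg_cst|exact: cvg_id|].
    exact: c2.
  - by move=> k; exact: dt0.
(* This is an equality of numbers, not merely modulo a full turn, because both phases are computed
   from the same samples. *)
have phi2 : phi (pi *+ 2) = phi 0.
  rewrite /phi; congr phase; apply/funext => k.
    by rewrite /p -[pi *+ 2]add0r (per _ _).1.
  by rewrite /q -[pi *+ 2]add0r (per _ _).2.
(* The difference takes opposite values at [0] and [pi], so it vanishes at some [th]. There the
   values on the unit circle at [th] and [th + pi] point the same way, although oddness makes them
   opposite. *)
have [th th0 dE] : exists2 th, th \in `[0, pi] & phi (th + pi) - phi th = 0.
  apply: (IVT (pi_ge0 R)).
    apply: continuous_in_subspaceT => th /set_mem /=.
    rewrite in_itv /= => /andP[th0 thpi].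
    have pi0 := @pi_ge0 R.
    apply: cvgB.
      apply: (@continuous_comp _ _ _ (fun x : R => x + pi) phi).
        by apply: cvgD; [exact: cvg_id|exact: cvg_cst].
      by apply: cphi; rewrite mulr2n; lra.
    by apply: cphi; rewrite mulr2n; lra.
  rewrite add0r -mulr2n phi2 ge_min le_max.
  by case: (lerP (phi 0) (phi pi)) => h; apply/andP; split; apply/orP;
    [right|left|left|right]; lra.
have pi0 := @pi_ge0 R.
move: th0; rewrite in_itv /= => /andP[th0 thpi].
have := rot th; have := rot (th + pi).
have -> : phi (th + pi) = phi th by lra.
case; first by rewrite mulr2n; lra.
move=> r' r'0 [E1' E2']; case; first by rewrite mulr2n; lra.
move=> r r0 [E1 E2].
move: E1' E2'; rewrite (odd th).1 (odd th).2.
set u := cos _ * _ - _ in E1 *; set v := sin _ * _ + _ in E2 *.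
rewrite E1 E2 => E1' E2'.
have u0 : u = 0.
  have : (r + r') * u = 0 by rewrite mulrDl -E1' subrr.
  by move/eqP; rewrite mulf_eq0 gt_eqF ?addr_gt0//= => /eqP.
have v0 : v = 0.
  have : (r + r') * v = 0 by rewrite mulrDl -E2' subrr.
  by move/eqP; rewrite mulf_eq0 gt_eqF ?addr_gt0//= => /eqP.
by case: (nz (1, th)); rewrite ?E1 ?E2 ?u0 ?v0 mulr0 eqxx.
Qed.

End Planar.

Lemma within_comp_continuous (S T U : topologicalType) (A : set S) (B : set T)
    (f : S -> T) (g : T -> U) :
  {within A, continuous f} -> {within B, continuous g} ->
  (forall x, A x -> B (f x)) -> {within A, continuous (g \o f)}.
Proof.
move=> cf cg AB; rewrite continuous_subspace_in => x /set_mem Ax W Wgf.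
have := cg (f x) W Wgf; rewrite /nbhs /= -nbhs_subspace_in; last exact: AB.
move=> BW; have := cf x; rewrite /continuous_at /nbhs /= => cfx.
rewrite /nbhs /= -nbhs_subspace_in//.
have : within A (nbhs x) (f @^-1` [set y | B y -> W (g y)]).
  by rewrite nbhs_subspace_in//; exact: cfx.
apply: filter_app; apply: filterS (withinT _ (nbhs_filter x)) => y Ay /=.
by apply; exact: AB.
Qed.

Lemma within_setT_continuous (S T : topologicalType) (f : S -> T) :
  {within setT, continuous f} -> continuous f.
Proof. by move=> cf x; have := cf x; rewrite /continuous_at nbhs_subspaceT. Qed.

(** * Triod times interval in the plane *)

Section Triod.
Variable R : realType.

Lemma max_continuous (T : topologicalType) (f g : T -> R) (x : T) :
  {for x, continuous f} -> {for x, continuous g} ->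
  {for x, continuous (fun y => Num.max (f y) (g y))}.
Proof.
move=> cf cg.
have -> : (fun y => Num.max (f y) (g y)) =
    (fun y => (f y + g y + `|f y - g y|) / 2).
  by apply/funext => y; rewrite maxr_absE.
apply: cvgM; last exact: cvg_cst.
apply: cvgD; first exact: cvgD.
by apply: cvg_norm; apply: cvgB.
Qed.

(** The triod is the union of the unit segments on the three positive coordinate axes: the vanishing
    products allow at most one nonzero coordinate. The last component runs along the interval. *)
Definition triod_strip : set ((R * R * R) * R) :=
  [set z | let: (a, b, c, l) := z in
   [/\ 0 <= a <= 1, 0 <= b <= 1, 0 <= c <= 1 & 0 <= l <= 1] /\
   [/\ a * b = 0, b * c = 0 & c * a = 0]].

(** The plane is cut into three sectors by the rays [p = q >= 0], [p = 0 >= q] and [q = 0 >= p].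
    Each open sector goes to one leg, and the rays go to the centre. *)
Definition tip (p q : R) : R * R * R :=
  (Num.max 0 (p - Num.max q 0), Num.max 0 (q - Num.max p 0),
   Num.max 0 (- Num.max p q)).

(** In each coordinate the two arguments of the outer maximum add up to [-|q|], [-|p|] or
    [-|p - q|], so equal maxima must both be 0. Hence both points go to the centre, and no nonzero
    vector lies on the three rays together with its opposite. *)
Lemma tip_antipode (p q : R) : tip p q = tip (- p) (- q) -> p = 0 /\ q = 0.
Proof.
have eq_max0 (x y : R) :
    Num.max 0 x = Num.max 0 y -> x + y <= 0 -> x <= 0 /\ y <= 0.
  by case: (lerP 0 x) => hx; case: (lerP 0 y) => hy; lra.
case=> /eq_max0 ha /eq_max0 hb /eq_max0 hc.
have [|p1 p2] := ha.
  by case: (lerP q 0) => h1; case: (lerP (- q) 0) => h2; lra.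
have [|q1 q2] := hb.
  by case: (lerP p 0) => h1; case: (lerP (- p) 0) => h2; lra.
have [|c1 c2] := hc.
  by case: (lerP p q) => h1; case: (lerP (- p) (- q)) => h2; lra.
move: p1 p2 q1 q2 c1 c2; clear ha hb hc.
rewrite !subr_le0 !oppr_le0 !le_max; lra.
Qed.

Lemma tip_in_triod (r p q l : R) : 0 <= r <= 1 -> 0 <= l <= 1 ->
  p ^+ 2 + q ^+ 2 = 1 ->
  triod_strip (r * (tip p q).1.1, r * (tip p q).1.2, r * (tip p q).2, l).
Proof.
move=> r01 l01 pq1.
have p1 : -1 <= p <= 1 by nra.
have q1 : -1 <= q <= 1 by nra.
have bnd (x : R) : x <= 1 -> 0 <= r * Num.max 0 x <= 1.
  by case: (lerP 0 x) => h x1; nra.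
have disj (x y : R) : x <= 0 \/ y <= 0 ->
    r * Num.max 0 x * (r * Num.max 0 y) = 0.
  by case=> h; rewrite (max_idPl h) !mulr0 ?mul0r.
rewrite /tip /=.
have [mp mp0 mq mq0] : [/\ p <= Num.max p 0, 0 <= Num.max p 0,
    q <= Num.max q 0 & 0 <= Num.max q 0] by rewrite !le_max !lexx !orbT.
have mpq1 : p <= Num.max p q by rewrite le_max lexx.
have mpq2 : q <= Num.max p q by rewrite le_max lexx orbT.
split; split=> //; try (by apply: bnd; lra); apply: disj.
- by have [h|h] := lerP p q; [left|right]; lra.
- by have [h|h] := lerP q 0; [left|right]; lra.
- by have [h|h] := lerP p 0; [right|left]; lra.
Qed.

(* Moving the second point up the strip makes the loop of pairs
   [(tip u, tip (- u))] of distinct points of the triod contractible among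
   pairs of distinct points, although it is odd. *)
Lemma triod_strip_not_planar (F : (R * R * R) * R -> R * R) :
  {within triod_strip, continuous F} ->
  (forall x y, triod_strip x -> triod_strip y -> F x = F y -> x = y) ->
  False.
Proof.
move=> cF injF.
(* Clamping the radius to [[0, 1]] extends the homotopy continuously to the whole plane of polar
   coordinates. *)
pose cl (rho : R) : R := Num.max 0 (1 - Num.max 0 (1 - rho)).
have cl01 rho : 0 <= cl rho <= 1.
  rewrite /cl; case: (lerP 0 (1 - rho)) => h.
    by case: (lerP 0 (1 - (1 - rho))) => h'; lra.
  by rewrite subr0; case: (lerP 0 1) => h'; lra.
have cl0 : cl 0 = 0 by rewrite /cl subr0 (max_idPr ler01) subrr maxxx.
have cl1 : cl 1 = 1 by rewrite /cl subrr maxxx subr0 (max_idPr ler01).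
have ccl : continuous (fun z : R * R => cl z.1).
  move=> z; apply: (@max_continuous _ (fun=> 0)
    (fun z : R * R => 1 - Num.max 0 (1 - z.1))); first exact: cvg_cst.
  apply: cvgB; first exact: cvg_cst.
  apply: (@max_continuous _ (fun=> 0) (fun z : R * R => 1 - z.1)).
    exact: cvg_cst.
  by apply: cvgB; [exact: cvg_cst | exact: cvg_fst].
pose sc (r : R) (t : R * R * R) (l : R) : (R * R * R) * R :=
  (r * t.1.1, r * t.1.2, r * t.2, l).
(* At radius 0 the points sit over the centre at heights 0 and 1; at radius 1 both have height 0 and
   a half turn interchanges them. Equal heights force radius 1, where [tip_antipode] keeps the
   points apart. *)
pose H1 (z : R * R) := sc (cl z.1) (tip (cos z.2) (sin z.2)) 0.
pose H2 (z : R * R) := sc (cl z.1) (tip (- cos z.2) (- sin z.2)) (1 - cl z.1).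
have DH1 z : triod_strip (H1 z).
  by apply: tip_in_triod => //; [rewrite lexx ler01 | exact: cos2Dsin2].
have DH2 z : triod_strip (H2 z).
  apply: tip_in_triod => //; last by rewrite !sqrrN cos2Dsin2.
  by have := cl01 z.1; lra.
have csc (p q l : R * R -> R) : continuous p -> continuous q -> continuous l ->
    continuous (fun z => sc (cl z.1) (tip (p z) (q z)) (l z)).
  move=> cp cq cl' z.
  have c0 (f : R * R -> R) : continuous f -> {for z, continuous (fun y => Num.max 0 (f y))}.
    by move=> cf; apply: max_continuous; [exact: cvg_cst | exact: cf].
  rewrite /sc; apply: (@continuous_pairfun _ _ _ _ id); [|exact: cl'|exact: cvg_id].
  apply: (@continuous_pairfun _ _ _ _ id); [|idtac|exact: cvg_id].
    apply: (@continuous_pairfun _ _ _ _ id); [idtac|idtac|exact: cvg_id].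
  - apply: cvgM; first exact: ccl.
    apply: c0 => y; apply: cvgB; first exact: cp.
    by apply: max_continuous; [exact: cq | exact: cvg_cst].
  - apply: cvgM; first exact: ccl.
    apply: c0 => y; apply: cvgB; first exact: cq.
    by apply: max_continuous; [exact: cp | exact: cvg_cst].
  - apply: cvgM; first exact: ccl.
    apply: c0 => y; apply: cvgN.
    by apply: max_continuous; [exact: cp | exact: cq].
have ccos : continuous (fun z : R * R => cos z.2).
  by move=> z; apply: (@continuous_comp _ _ _ snd cos); [exact: cvg_snd | exact: continuous_cos].
have csin : continuous (fun z : R * R => sin z.2).
  by move=> z; apply: (@continuous_comp _ _ _ snd sin); [exact: cvg_snd | exact: continuous_sin].
have cFH (H : R * R -> (R * R * R) * R) : continuous H ->
    (forall z, triod_strip (H z)) -> continuous (F \o H).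
  move=> cH DH; apply: within_setT_continuous.
  by apply: within_comp_continuous (continuous_subspaceT cH) cF _ => z _.
have cFH1 : continuous (F \o H1).
  by apply: cFH => //; apply: csc => // z; exact: cvg_cst.
have cFH2 : continuous (F \o H2).
  apply: cFH => //; apply: csc => z.
  - by apply: cvgN; exact: ccos.
  - by apply: cvgN; exact: csin.
  - by apply: cvgB; [exact: cvg_cst | exact: ccl].
apply: (@no_odd_planar_map R (fun z => (F (H1 z)).1 - (F (H2 z)).1)
  (fun z => (F (H1 z)).2 - (F (H2 z)).2)).
- move=> z; apply: cvgB.
    by apply: (@continuous_comp _ _ _ (F \o H1) fst); [exact: cFH1 | exact: cvg_fst].
  by apply: (@continuous_comp _ _ _ (F \o H2) fst); [exact: cFH2 | exact: cvg_fst].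
- move=> z; apply: cvgB.
    by apply: (@continuous_comp _ _ _ (F \o H1) snd); [exact: cFH1 | exact: cvg_snd].
  by apply: (@continuous_comp _ _ _ (F \o H2) snd); [exact: cFH2 | exact: cvg_snd].
- move=> z; apply/orP; rewrite -negb_and; apply/negP => /andP[].
  rewrite !subr_eq0 => /eqP e1 /eqP e2.
  have : H1 z = H2 z.
    by apply: injF => //; case: (F _) (F _) e1 e2 => ? ? [? ?] /= -> ->.
  rewrite /H1 /H2 /sc => -[].
  move=> ea eb ec el; have c1 : cl z.1 = 1 by lra.
  move: ea eb ec; rewrite c1 !mul1r => ea eb ec.
  have [p0 q0] : cos z.2 = 0 /\ sin z.2 = 0.
    by apply: tip_antipode; rewrite /tip ea eb ec.
  have := @cos2Dsin2 R z.2; rewrite p0 q0 expr0n addr0 => /esym/eqP.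
  by rewrite oner_eq0.
- by move=> th; rewrite /H1 /H2 /sc /= cl0 !mul0r.
- by move=> rho th; rewrite /H1 /H2 /sc /= cosD2pi sinD2pi.
- move=> th; rewrite /H1 /H2 /sc /= cl1 cosDpi sinDpi !opprK subrr.
  by rewrite !opprB.
Qed.

End Triod.

(** * Sheets of an origami map *)

Section Space.
Variable R : realType.
Implicit Types (u v w : 'rV[R]_3) (c eta : R -> 'rV[R]_3).

Lemma vec3E (x y z : R) :
  [/\ vec3 x y z 0 0 = x, vec3 x y z 0 1 = y & vec3 x y z 0 2 = z].
Proof. by rewrite !mxE. Qed.

Lemma vec3_eta u : u = vec3 (u 0 0) (u 0 1) (u 0 2).
Proof.
by apply/rowP => -[[|[|[|//]]] h]; rewrite mxE /=; congr (u _ _); apply/val_inj.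
Qed.

Lemma dotE u v : dot u v = u 0 0 * v 0 0 + u 0 1 * v 0 1 + u 0 2 * v 0 2.
Proof.
rewrite /dot !big_ord_recl big_ord0 addr0 addrA.
by congr (_ * _ + _ * _ + _ * _); congr (_ _ _); apply/val_inj.
Qed.

Lemma derive_coord c (s : R) (j : 'I_3) :
  derivable c s 1 -> is_derive s 1 (fun y => c y 0 j) ('D_1 c s 0 j).
Proof.
move=> dc; have dcj := (iffLR (derivable_mxP c s 1) dc) 0 j.
by apply: DeriveDef => //; rewrite derive_mx// mxE.
Qed.

(* A non-convergent difference quotient has the junk limit [point = 0]. *)
Lemma derive_neq0_derivable (f : R -> 'rV[R]_3) (s : R) :
  'D_1 f s != 0 -> derivable f s 1.
Proof.
apply: contra_neqP => /dvgP; rewrite /derive => ->.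
by apply/rowP => j; rewrite !mxE.
Qed.

Lemma pd_v_ruled c eta (x : R * R) : pd_v (ruled c eta) x = eta x.1.
Proof.
rewrite /pd_v /derive; apply/cvg_lim => //; apply: cvg_near_cst.
near=> h; rewrite /ruled /= [h *: 0]mulr0 add0r [h *: 1]mulr1.
rewrite opprD addrACA subrr add0r scalerDl addrK scalerA mulVf ?scale1r//.
by near: h; exact: nbhs_dnbhs_neq.
Unshelve. all: by end_near. Qed.

Lemma pd_s_ruled c eta (x : R * R) :
  pd_s (ruled c eta) x = 'D_1 (fun s => c s + x.2 *: eta s) x.1.
Proof.
rewrite /pd_s /derive; congr (lim _).
apply: (congr1 (fun f : R -> 'rV[R]_3 => f @ 0^')); apply/funext => h.
by rewrite /ruled /= [h *: 0]mulr0 add0r.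
Qed.

Lemma derive0_eq (f : R -> R) (x y : R) : x <= y ->
  {within `[x, y], continuous f} ->
  (forall s, x < s < y -> is_derive s 1 f 0) -> f x = f y.
Proof.
move=> xy cf df.
have df' s : s \in `]x, y[ -> is_derive s 1 f 0 by rewrite in_itv => /df.
have [_ _] := MVT_segment xy df' cf.
by rewrite mul0r => /eqP; rewrite subr_eq0 => /eqP.
Qed.

End Space.

Section Sheets.
Variables (R : realType) (b L : R) (zeta : R -> R).
Hypothesis Hdata : fundamental_data b L zeta.
Implicit Types (c xi : R -> 'rV[R]_3).

Let b0 : 0 < b. Proof. by have [] := Hdata. Qed.
Let L0 : 0 < L. Proof. by have [] := Hdata. Qed.
Let dz (s : R) : 0 <= s <= L -> derivable zeta s 1.
Proof.
have [_ _ [V [_ sV dV]] _] := Hdata => s01.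
by apply: (dV 0%N); apply: sV; rewrite /= in_itv.
Qed.
Let slope (s : R) : 0 <= s <= L -> 2 * (derive1 zeta s) ^+ 2 < 1.
Proof. by have [_ _ _ [h _ _ _ _]] := Hdata => /h; rewrite subr_gt0. Qed.
Let z0 : zeta 0 = 0. Proof. by have [_ _ _ []] := Hdata. Qed.
Let zL : zeta L = 0. Proof. by have [_ _ _ []] := Hdata. Qed.
Let zb (s : R) : 0 < s < L -> 0 < zeta s < b.
Proof. by have [_ _ _ [_ _ _ h _]] := Hdata => /h. Qed.

Lemma zeta_continuous (s : R) : 0 <= s <= L -> {for s, continuous zeta}.
Proof. by move=> /dz h; exact/differentiable_continuous/derivable1_diffP. Qed.

Lemma zeta_lt (s : R) : 0 <= s <= L -> 0 <= zeta s < b.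
Proof.
move=> /andP[]; rewrite le_eqVlt => /orP[/eqP <- _|s0]; first by rewrite z0 lexx b0.
rewrite le_eqVlt => /orP[/eqP -> |sL]; first by rewrite zL lexx b0.
by have /andP[/ltW -> ->] := zb (introT andP (conj s0 sL)).
Qed.

Lemma domUplusP (s v : R) : 0 <= s <= L -> 0 <= v <= zeta s ->
  domUplus b L zeta (s, v).
Proof.
move=> s01 /andP[v0 vz]; split => //=; split=> //=.
by rewrite vz andbT; have := zeta_lt s01; lra.
Qed.

(* [E = 1] on the sheet reads [1 = |c' + v xi'|^2 = 1 + 2 v c'.xi' + v^2 |xi'|^2]
   for all [0 <= v <= zeta s]. *)
Lemma ruling_derive0 c xi (s : R) : 0 < s < L -> derivable c s 1 ->
  first_form_is_g L zeta (domUplus b L zeta) (ruled c xi) ->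
  [/\ dot ('D_1 c s) ('D_1 c s) = 1, dot ('D_1 c s) (xi s) = - derive1 zeta s,
      dot (xi s) (xi s) = 1 & is_derive s 1 xi 0].
Proof.
move=> s01 dc ff; have /andP[z_gt0 _] := zb s01.
have s01' : 0 <= s <= L by lra.
pose D v := 'D_1 (fun y => c y + v *: xi y) s.
have DE v : 0 <= v <= zeta s -> dot (D v) (D v) = 1.
  move=> vz; have [+ _ _] := ff _ (domUplusP s01' vz) s01.
  by rewrite /first_formE pd_s_ruled; apply.
have D0 : D 0 = 'D_1 c s.
  by congr ('D_1 _ s); apply/funext => y; rewrite scale0r addr0.
have c1 : dot ('D_1 c s) ('D_1 c s) = 1 by rewrite -D0 DE// lexx ltW.
have [_] := ff _ (domUplusP s01' (introT andP (conj (lexx 0) (ltW z_gt0)))) s01.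
rewrite /first_formF /first_formG pd_v_ruled pd_s_ruled -/(D 0) D0 /= => cxi xixi.
(* Differentiability of [xi] is extracted from that of [c + zeta s *: xi], whose derivative has
   length 1 and so is not the default value 0. *)
have dxi : derivable xi s 1.
  have dcz : derivable (fun y => c y + zeta s *: xi y) s 1.
    apply: derive_neq0_derivable; apply/eqP => D0'.
    have := DE (zeta s); rewrite /D D0' dotE !mxE lexx ltW// => /(_ isT).
    by rewrite !mulr0 !addr0 => /esym/eqP; rewrite oner_eq0.
  have -> : xi = (zeta s)^-1 \*: ((fun y => c y + zeta s *: xi y) - c).
    apply/funext => y /=; rewrite /GRing.scale_fun /=.
    have -> : ((fun y => c y + zeta s *: xi y) - c) y = zeta s *: xi y.
      by rewrite fctE /= addrC addKr.
    by rewrite scalerA mulVf ?scale1r// gt_eqF.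
  by apply: derivableZ; apply: derivableB.
split=> //; apply: DeriveDef => //.
have Dv v : D v = 'D_1 c s + v *: 'D_1 xi s.
  by rewrite /D (deriveD dc (derivableZ (k := v) dxi)) deriveZ.
(* A quadratic polynomial in [v] equal to 1 at [0], [zeta s / 2] and [zeta s] has zero leading
   coefficient, here the squared length of [xi']. *)
have hz : 0 <= zeta s <= zeta s by rewrite lexx ltW.
have hz2 : 0 <= zeta s / 2 <= zeta s by lra.
move: c1 (DE _ hz2) (DE _ hz); rewrite !Dv !dotE !mxE.
move: ('D_1 c s) ('D_1 xi s) => p q c1 h1 h2.
have q0 : q 0 0 ^+ 2 + q 0 1 ^+ 2 + q 0 2 ^+ 2 = 0.
  apply: (@mulfI _ (zeta s ^+ 2)); first by rewrite sqrf_eq0 gt_eqF.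
  by rewrite mulr0; lra.
move/eqP: q0; rewrite !paddr_eq0 ?addr_ge0 ?sqr_ge0// !sqrf_eq0.
move=> /andP[/andP[/eqP q0 /eqP q1] /eqP q2]; rewrite (vec3_eta q) q0 q1 q2.
by apply/rowP => -[[|[|[|//]]] h]; rewrite !mxE.
Qed.

Lemma coord_within (A : set R) c (j : 'I_3) :
  {within A, continuous c} -> {within A, continuous (fun s => c s 0 j)}.
Proof.
move=> cc; apply: (within_comp_continuous (B := setT) (g := fun u : 'rV[R]_3 => u 0 j) cc) => //.
exact/continuous_subspaceT/coord_continuous.
Qed.

Lemma zeta_within (A : set R) : A `<=` `[0, L] -> {within A, continuous zeta}.
Proof.
move=> AL; apply: continuous_in_subspaceT => s /set_mem /AL /=.
by rewrite in_itv; exact: zeta_continuous.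
Qed.

Section Crease.
Variables c xi : R -> 'rV[R]_3.
Hypotheses (cc : {within `[0, L], continuous c})
  (cinj : {in `[0, L] &, injective c})
  (dc : forall s, 0 < s < L -> derivable c s 1)
  (ffp : first_form_is_g L zeta (domUplus b L zeta) (ruled c xi))
  (ffm : first_form_is_g L zeta (domUminus b L zeta) (ruled c (fun=> xi_check R)))
  (ax0 : on_x_axis (c 0)) (axL : on_x_axis (c L)).

(** On the lower sheet, with ruling [(0, -1, 0)], the coefficient [F] at [v = 0] reads
    [- c_y' = - zeta'], and both functions start at 0. *)
Lemma crease_height (s : R) : 0 <= s <= L -> c s 0 1 = zeta s.
Proof.
move=> /andP[s0 sL].
have := @derive0_eq R (fun y => c y 0 1 - zeta y) 0 s s0 _ _.
rewrite ax0.1 z0 subrr => /(_ _ _)/esym/eqP; rewrite subr_eq0 => h; apply/eqP/h.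
  have sub : `[0, s]%classic `<=` `[0, L]%classic.
    by move=> y /=; rewrite !in_itv /= => /andP[-> /le_trans ->].
  move=> y; apply: cvgB; last exact: zeta_within.
  exact/coord_within/(continuous_subspaceW sub).
move=> y /andP[y0 ys].
have y01 : 0 < y < L by rewrite y0 (lt_le_trans ys).
have y01' : 0 <= y <= L by lra.
have Uy : domUminus b L zeta (y, 0).
  by split => //; split=> //=; have := zeta_lt y01'; lra.
have [_ + _] := ffm Uy y01.
rewrite /first_formF pd_v_ruled pd_s_ruled /= dotE /xi_check.
have -> : (fun s => c s + 0 *: vec3 0 (-1) 0) = c.
  by apply/funext => ?; rewrite scale0r addr0.
have [-> -> ->] := vec3E (0 : R) (-1) 0; rewrite !mulr0 addr0 add0r mulrN1.
move=> /oppr_inj E.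
have d1 := derive_coord 1 (dc y01).
have d2 : is_derive y 1 zeta (derive1 zeta y).
  by rewrite derive1E; apply: derivableP; exact: dz.
have -> : 0 = 'D_1 c y 0 1 - derive1 zeta y by rewrite E subrr.
exact: is_deriveB.
Qed.

(** The ruling has zero derivative, hence is constant. Then [F = - zeta'] integrates to constancy of
    [dot (c s) eta + zeta s]. Comparing the two distinct end points on the x-axis gives [eta_x = 0],
    and comparing [0] with [s] ties [c_z] to [zeta]. *)
Lemma crease_sheet : exists eta : 'rV[R]_3,
  [/\ forall s, 0 < s < L -> xi s = eta,
      eta 0 0 = 0, eta 0 1 ^+ 2 + eta 0 2 ^+ 2 = 1 &
      forall s, 0 <= s <= L -> zeta s * (1 + eta 0 1) + eta 0 2 * c s 0 2 = 0].
Proof.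
have L2 : 0 < L / 2 < L by have := L0; lra.
have xi_eq (x y : R) : 0 < x -> x <= y -> y < L -> xi x = xi y.
  move=> x0 xy yL; apply/rowP => j; apply: (@derive0_eq R (fun s => xi s 0 j) _ _ xy).
    apply: derivable_within_continuous => s; rewrite in_itv /= => sxy.
    have s01 : 0 < s < L by lra.
    have [_ _ _ [dxi _]] := ruling_derive0 s01 (dc s01) ffp.
    exact: (iffLR (derivable_mxP _ _ _) dxi).
  move=> s sxy; have s01 : 0 < s < L by lra.
  have [_ _ _ [dxi D0]] := ruling_derive0 s01 (dc s01) ffp.
  by have := derive_coord j dxi; rewrite D0 mxE.
pose eta := xi (L / 2).
have xiE s : 0 < s < L -> xi s = eta.
  move=> /andP[s0 sL]; rewrite /eta; case: (leP s (L / 2)) => h.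
    by apply: xi_eq => //; lra.
  by apply/esym/xi_eq => //; lra.
have key s : 0 <= s <= L -> dot (c 0) eta = dot (c s) eta + zeta s.
  move=> /andP[s0 sL].
  have := @derive0_eq R (fun y => dot (c y) eta + zeta y) 0 s s0 _ _.
  rewrite z0 addr0; apply.
    have sub : `[0, s]%classic `<=` `[0, L]%classic.
      by move=> y /=; rewrite !in_itv /= => /andP[-> /le_trans ->].
    have cj j := coord_within (j := j) (continuous_subspaceW sub cc).
    have -> : (fun y => dot (c y) eta + zeta y) = (fun y =>
        c y 0 0 * eta 0 0 + c y 0 1 * eta 0 1 + c y 0 2 * eta 0 2 + zeta y).
      by apply/funext => y; rewrite dotE.
    move=> y; apply: cvgD; last exact: zeta_within.
    by do ?apply: cvgD; apply: cvgM; (exact: cj || exact: cvg_cst).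
  move=> y ys; have y01 : 0 < y < L by lra.
  have y01' : 0 <= y <= L by lra.
  have [_ + _ _] := ruling_derive0 y01 (dc y01) ffp; rewrite xiE// dotE => E.
  have d0 := derive_coord 0 (dc y01).
  have d1 := derive_coord 1 (dc y01).
  have d2 := derive_coord 2 (dc y01).
  have dze : is_derive y 1 zeta (derive1 zeta y).
    by rewrite derive1E; apply: derivableP; exact: dz.
  have -> : (fun y => dot (c y) eta + zeta y) = (fun y => eta 0 0 * c y 0 0 +
      eta 0 1 * c y 0 1 + eta 0 2 * c y 0 2 + zeta y).
    by apply/funext => x; rewrite dotE; ring.
  apply: is_derive_eq.
  rewrite /GRing.scale /=; lra.
have e0 : eta 0 0 = 0.
  have := key L (introT andP (conj (ltW L0) (lexx L))).
  rewrite zL addr0 !dotE ax0.1 ax0.2 axL.1 axL.2 !mul0r !addr0 => E.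
  have : (c 0 0 0 - c L 0 0) * eta 0 0 = 0 by rewrite mulrBl E subrr.
  move=> /eqP; rewrite mulf_eq0 => /orP[|/eqP//].
  rewrite subr_eq0 => /eqP xE; exfalso.
  have : c 0 = c L.
    by rewrite (vec3_eta (c 0)) (vec3_eta (c L)) xE ax0.1 ax0.2 axL.1 axL.2.
  move/cinj; rewrite !bound_itvE !ltW// => /(_ isT isT) E0.
  by move: L0; rewrite -E0 ltxx.
exists eta; split => // [|s s01].
  have [_ _ + _] := ruling_derive0 L2 (dc L2) ffp.
  by rewrite dotE e0 mulr0 add0r -!expr2.
have := key s s01; rewrite !dotE ax0.1 ax0.2 e0 crease_height//; lra.
Qed.

End Crease.

(** Unit speed gives [x'^2 = 1 - (1 + lam^2) zeta'^2 >= 1 - 2 zeta'^2 > 0], so equal values of [x]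
    would contradict Rolle's theorem. *)
Lemma crease_x_inj c (lam : R) : lam ^+ 2 <= 1 ->
  {within `[0, L], continuous c} ->
  (forall s, 0 < s < L -> derivable c s 1) ->
  (forall s, 0 < s < L -> dot ('D_1 c s) ('D_1 c s) = 1) ->
  (forall s, 0 <= s <= L -> c s 0 1 = zeta s /\ c s 0 2 = lam * zeta s) ->
  {in `[0, L] &, injective (fun s => c s 0 0)}.
Proof.
move=> lam1 cc dc c1 cE.
suff lt x y : 0 <= x -> x < y -> y <= L -> c x 0 0 <> c y 0 0.
  move=> x y; rewrite !in_itv /= => /andP[x0 xL] /andP[y0 yL] E.
  by case: (ltgtP x y) => // h; exfalso; [apply: (lt x y)|apply: (lt y x)].
move=> x0 xy yL E.
have [||s] := @Rolle R (fun s => c s 0 0) x y xy _ _ E.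
- move=> s; rewrite in_itv /= => sxy; apply: (iffLR (derivable_mxP _ _ _)).
  by apply: dc; lra.
- apply: coord_within; apply: continuous_subspaceW cc => s /=.
  by rewrite !in_itv /=; lra.
rewrite in_itv /= => sxy [_ D0].
have s01 : 0 < s < L by lra.
have s01' : 0 <= s <= L by lra.
have [_ E0] := derive_coord 0 (dc s s01).
have [_ E1] := derive_coord 1 (dc s s01).
have [_ E2] := derive_coord 2 (dc s s01).
have nr : \forall z \near s, 0 < z < L.
  have /andP[s0 sL] := s01.
  by near=> z; apply/andP; split; near: z; [exact: lt_nbhsr|exact: lt_nbhsl].
have F1 : 'D_1 (fun y => c y 0 1) s = derive1 zeta s.
  rewrite derive1E; apply: near_eq_derive; apply: filterS nr => z /andP[z_gt0 zltL].
  by rewrite (cE z _).1// !ltW.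
have F2 : 'D_1 (fun y => c y 0 2) s = lam * derive1 zeta s.
  rewrite derive1E.
  have -> : lam * 'D_1 zeta s = 'D_1 (lam \*: zeta) s by rewrite deriveZ//; exact: dz.
  apply: near_eq_derive; apply: filterS nr => z /andP[z_gt0 zltL].
  by rewrite (cE z _).2// !ltW.
have := c1 s s01; have := slope s01'.
rewrite dotE -E0 -E1 -E2 D0 F1 F2; nra.
Unshelve. all: by end_near. Qed.

End Sheets.

(** * Local planarity of the pillow box *)

Section Chart.
Variables (R : realType) (b L : R) (zeta : R -> R).
Hypothesis Hdata : fundamental_data b L zeta.
Let L0 : 0 < L. Proof. by have [] := Hdata. Qed.

(** Strict concavity as decrease of chord slopes, cross-multiplied. The mean value theorem is used
    on each chord and then on [zeta'], so [zeta'' < 0] is only evaluated inside [(0, L)] even if [x]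
    or [z] is an end point. *)
Lemma zeta_chords (x y z : R) : 0 <= x -> x < y -> y < z -> z <= L ->
  (zeta z - zeta y) * (y - x) < (zeta y - zeta x) * (z - y).
Proof.
move=> x0 xy yz zL; have [_ _ [V [_ sV dV]] [_ _ _ _ conc]] := Hdata.
have d n s : 0 <= s <= L -> derivable (derive1n n zeta) s 1.
  by move=> s01; apply: dV; apply: sV; rewrite /= in_itv.
have chord n (p q : R) : 0 <= p -> p < q -> q <= L ->
    exists2 m, p < m < q & derive1n n zeta q - derive1n n zeta p
                           = derive1n n.+1 zeta m * (q - p).
  move=> p0 pq qL.
  have df s : s \in `]p, q[ -> is_derive s 1 (derive1n n zeta) (derive1n n.+1 zeta s).
    rewrite in_itv /= => spq; rewrite derive1E.
    by apply: derivableP; apply: d; lra.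
  have cf : {within `[p, q], continuous (derive1n n zeta)}.
    apply: derivable_within_continuous => s; rewrite in_itv /= => spq.
    by apply: d; lra.
  by have [m + E] := MVT pq df cf; rewrite in_itv /= => mpq; exists m.
have [m1 h1 E1] := chord 0%N x y x0 xy (ltW (lt_le_trans yz zL)).
have [m2 h2 E2] := chord 0%N y z (le_trans x0 (ltW xy)) yz zL.
have [| | | m h E] := chord 1%N m1 m2; [lra..|].
have cm : derive1n 2 zeta m < 0 by apply: conc; lra.
move: E1 E2; rewrite derive1n0 => -> ->.
have : derive1n 1 zeta m2 < derive1n 1 zeta m1.
  by rewrite -subr_lt0 E pmulr_llt0// subr_gt0; lra.
move: (derive1n 1 zeta m1) (derive1n 1 zeta m2) => p q pq.
by rewrite -!mulrA [(z - y) * _]mulrC ltr_pM2r// mulr_gt0 ?subr_gt0.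
Qed.

(** Boundary of the rectangle with half-sides [h1] and [h2] centred at the origin. *)
Definition box_edge (h1 h2 y z : R) : Prop :=
  (`|y| = h1 /\ `|z| <= h2) \/ (`|y| <= h1 /\ `|z| = h2).

Lemma box_edge_scale (k1 k2 h1 h2 y z : R) : 0 < k1 -> 0 < k2 ->
  box_edge h1 h2 y z -> box_edge (k1 * h1) (k2 * h2) (k1 * y) (k2 * z).
Proof.
move=> k10 k20; rewrite /box_edge !normrM (gtr0_norm k10) (gtr0_norm k20).
case=> -[hy hz]; [left|right].
  by rewrite hy ler_pM2l.
by rewrite hz ler_pM2l.
Qed.

Lemma box_edge_nested (h1 h2 h1' h2' y z : R) : h1 < h1' -> h2 < h2' ->
  box_edge h1 h2 y z -> box_edge h1' h2' y z -> False.
Proof. by move=> h1h h2h [] [? ?] [] [? ?]; lra. Qed.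

(** On [U_+] the sheet has [y = zeta] with [z] between 0 and [zeta]; on [U_-] it has [z = zeta] with
    [y] between [zeta] and [b]. The reflections complete these two edges to a rectangle centred at
    [(b, 0)]. *)
Lemma pillow_box_cross_section (u : 'rV[R]_3) : pillow_box b L zeta u ->
  exists s, [/\ 0 <= s <= L, u 0 0 = pillow_curve zeta s 0 0 &
                box_edge (b - zeta s) (zeta s) (u 0 1 - b) (u 0 2)].
Proof.
have main (w : 'rV[R]_3) : (origami_param zeta @` domU b L zeta) w ->
    exists s, [/\ 0 <= s <= L, w 0 0 = pillow_curve zeta s 0 0 &
                  box_edge (b - zeta s) (zeta s) (w 0 1 - b) (w 0 2)].
  move=> [[s v] [/= s01 vz] <-]; exists s; split=> //.
    by rewrite /origami_param /=; case: ifP => _; rewrite !mxE /= mulr0 addr0.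
  have zs := zeta_lt Hdata s01.
  rewrite /origami_param /=; case: (lerP 0 v) => v0; rewrite !mxE /=.
    left; rewrite mulr0 addr0 ler0_norm; last by lra.
    by split; [lra | rewrite ger0_norm; lra].
  right; split; first by rewrite ler_norml; lra.
  by rewrite mulr0 addr0 ger0_norm; lra.
case=> [[[|]|]|].
- exact: main.
- move=> [w /main[s [s01 x h]] <-]; exists s; split=> //.
    by rewrite mxE.
  rewrite !mxE /=.
  have -> : 2 * b - w 0 1 - b = - (w 0 1 - b) by ring.
  by rewrite /box_edge normrN.
- move=> [w /main[s [s01 x h]] <-]; exists s; split=> //.
    by rewrite mxE.
  rewrite !mxE /=.
  by rewrite /box_edge normrN.
- move=> [w /main[s [s01 x h]] <-]; exists s; split=> //.
    by rewrite /= [LHS]mxE /= [LHS]mxE.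
  rewrite !mxE /=.
  have -> : 2 * b - w 0 1 - b = - (w 0 1 - b) by ring.
  by rewrite /box_edge !normrN.
Qed.

Let x0 (s : R) : R := pillow_curve zeta s 0 0.
Hypotheses (cx0 : {within `[0, L], continuous x0})
  (x0inj : {in `[0, L] &, injective x0}).

Let sigma_ex : exists g : R -> R, forall s, 0 <= s <= L -> g (x0 s) = s.
Proof.
exists (fun x => get [set s | 0 <= s <= L /\ x0 s = x]) => s s01.
have [] : [set r | 0 <= r <= L /\ x0 r = x0 s] (get [set r | 0 <= r <= L /\ x0 r = x0 s]).
  by apply: getPex; exists s.
by move=> g01; apply: x0inj; rewrite in_itv.
Qed.

Let M := pillow_box b L zeta.

Section Sigma.
Variable g : R -> R.
Hypothesis gK : forall s, 0 <= s <= L -> g (x0 s) = s.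
Let sg (u : 'rV[R]_3) : R := g (u 0 0).

Lemma pillow_box_param (u : 'rV[R]_3) : M u ->
  [/\ 0 <= sg u <= L, u 0 0 = x0 (sg u) &
      box_edge (b - zeta (sg u)) (zeta (sg u)) (u 0 1 - b) (u 0 2)].
Proof.
move=> /pillow_box_cross_section[s [s01 x h]].
by rewrite /sg x gK.
Qed.

Lemma param_continuous : {within M, continuous sg}.
Proof.
apply: (@within_comp_continuous _ _ _ _ (x0 @` `[0, L]%classic)
    (fun u : 'rV[R]_3 => u 0 0) g).
- exact/continuous_subspaceT/coord_continuous.
- rewrite (continuous_inj_image_segment (ltW L0) cx0 x0inj).
  apply: (segment_can_continuous (ltW L0) cx0) => s.
  by rewrite in_itv; exact: gK.
- move=> u /pillow_box_param[s01 x _]; exists (sg u).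
    by rewrite /= in_itv.
  exact/esym.
Qed.

(* [k1] and [k2] rescale the cross-sections of the box so that they become
   nested rectangles. *)
Lemma nested_chart (S : set R) (k1 k2 : R -> R) :
  (forall s, S s -> 0 <= s <= L -> 0 < k1 s /\ 0 < k2 s) ->
  {within S `&` `[0, L], continuous k1} ->
  {within S `&` `[0, L], continuous k2} ->
  ((forall s r, S s -> S r -> 0 <= s -> s < r -> r <= L ->
     k1 s * (b - zeta s) < k1 r * (b - zeta r) /\
     k2 s * zeta s < k2 r * zeta r) \/
   (forall s r, S s -> S r -> 0 <= s -> s < r -> r <= L ->
     k1 r * (b - zeta r) < k1 s * (b - zeta s) /\
     k2 r * zeta r < k2 s * zeta s)) ->
  exists chi : 'rV[R]_3 -> R * R,
    {within [set u | M u /\ S (sg u)], continuous chi} /\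
    forall u w, M u -> S (sg u) -> M w -> S (sg w) -> chi u = chi w -> u = w.
Proof.
move=> k0 ck1 ck2 mono.
(* The x-coordinate is dropped. It is recovered because the boundaries of strictly nested rectangles
   are disjoint, so the image point determines [s]. *)
exists (fun u => (k1 (sg u) * (u 0 1 - b), k2 (sg u) * u 0 2)); split.
  have csg : {within [set u | M u /\ S (sg u)], continuous sg}.
    by apply: (continuous_subspaceW _ param_continuous) => u [].
  have ck (k : R -> R) : {within S `&` `[0, L], continuous k} ->
      {within [set u | M u /\ S (sg u)], continuous (fun u => k (sg u))}.
    move=> ck; apply: (within_comp_continuous csg ck) => u [Mu Su].
    by split => //=; rewrite in_itv /=; have [] := pillow_box_param Mu.
  have cj (j : 'I_3) : {within [set u | M u /\ S (sg u)],
      continuous (fun u : 'rV[R]_3 => u 0 j)}.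
    exact/continuous_subspaceT/coord_continuous.
  move=> u; apply: (@continuous_pairfun _ _ _ _ id
    (fun u : subspace _ => k1 (sg u) * (u 0 1 - b))
    (fun u : subspace _ => k2 (sg u) * u 0 2)); last exact: cvg_id.
    apply: cvgM; first exact: ck.
    by apply: cvgB; [exact: cj|exact: cvg_cst].
  by apply: cvgM; [exact: ck|exact: cj].
move=> u w Mu Su Mw Sw [e1 e2].
have [su xu eu] := pillow_box_param Mu.
have [sw xw ew] := pillow_box_param Mw.
have [k1u k2u] := k0 _ Su su; have [k1w k2w] := k0 _ Sw sw.
have hu := box_edge_scale k1u k2u eu.
have hw := box_edge_scale k1w k2w ew.
rewrite -e1 -e2 in hw.
have uw : sg u = sg w.
  case: (ltgtP (sg u) (sg w)) => // h; exfalso.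
    case: mono => mono; have [|||||a1 a2] := mono (sg u) (sg w); rewrite //; try lra.
      exact: box_edge_nested a1 a2 hu hw.
    exact: box_edge_nested a1 a2 hw hu.
  case: mono => mono; have [|||||a1 a2] := mono (sg w) (sg u); rewrite //; try lra.
    exact: box_edge_nested a1 a2 hw hu.
  exact: box_edge_nested a1 a2 hu hw.
rewrite (vec3_eta u) (vec3_eta w) xu xw uw.
move: e1 e2; rewrite uw => /(mulfI (lt0r_neq0 k1w)) /addIr -> .
by move=> /(mulfI (lt0r_neq0 k2w)) ->.
Qed.

End Sigma.

(** The regions [s < L] and [0 < s] cover the box. On each, concavity of [zeta] supplies scalings
    that nest the cross-sections, including the segment to which the section degenerates at the end
    it contains. *)
Lemma pillow_box_local_chart (u0 : 'rV[R]_3) : M u0 ->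
  exists (N : set 'rV[R]_3) (chi : 'rV[R]_3 -> R * R),
  [/\ within M (nbhs u0) N, {within M `&` N, continuous chi} &
      forall u w, M u -> N u -> M w -> N w -> chi u = chi w -> u = w].
Proof.
move=> Mu0; have [g gK] := sigma_ex.
have csg := param_continuous gK (x := u0).
have zL : zeta L = 0 by have [_ _ _ []] := Hdata.
have z0 : zeta 0 = 0 by have [_ _ _ []] := Hdata.
have nz (S : set R) : nbhs (g (u0 0 0)) S -> within M (nbhs u0) [set u | S (g (u 0 0))].
  by move=> nS; rewrite nbhs_subspace_in//; exact: csg.
have bz s : 0 <= s <= L -> 0 < b - zeta s.
  by move=> /(zeta_lt Hdata); lra.
have cz : {within `[0, L], continuous zeta} by exact: (zeta_within Hdata).
have cbz (k : R -> R) (S : set R) : continuous k -> {within S `&` `[0, L],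
    continuous (fun s => k s / (b - zeta s))}.
  move=> ck; rewrite continuous_subspace_in => s /set_mem[_ /=].
  rewrite in_itv /= => s01.
  apply: cvgM; first exact: (continuous_subspaceT ck).
  apply: cvgV; first by rewrite gt_eqF// bz.
  apply: cvgB; first exact: cvg_cst.
  exact: (continuous_subspaceW (@subIsetr _ _ _) cz).
have [s01 _ _] := pillow_box_param gK Mu0.
have [sL|Ls] := ltP (g (u0 0 0)) L.
  exists [set u | g (u 0 0) < L].
  (* The half-sides become [1 + s] and [zeta s / (L - s)]. The latter is minus the slope of the
     chord to [(L, 0)], so both increase. *)
  have [|||| chi [cchi ichi]] := @nested_chart g gK [set s | s < L]
      (fun s => (1 + s) / (b - zeta s)) (fun s => (L - s)^-1).
  - move=> s /= sL' s01'; split; last by rewrite invr_gt0 subr_gt0.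
    by rewrite divr_gt0 ?bz//; lra.
  - by apply: cbz => s; apply: cvgD; [exact: cvg_cst|exact: cvg_id].
  - apply: continuous_in_subspaceT => s /set_mem[/= sL' _].
    apply: cvgV; first by rewrite gt_eqF// subr_gt0.
    by apply: cvgB; [exact: cvg_cst|exact: cvg_id].
  - left=> s r /= sL' rL s0 sr rL'.
    rewrite !divfK ?gt_eqF ?bz//; try lra.
    split; first lra.
    rewrite ![_^-1 * _]mulrC ltr_pdivrMr ?subr_gt0// mulrAC ltr_pdivlMr ?subr_gt0//.
    by have := zeta_chords s0 sr rL (lexx L); rewrite zL; lra.
  exists chi; split => //; exact: (nz [set s | s < L] (lt_nbhsl sL)).
have s0 : 0 < g (u0 0 0) by have := L0; lra.
exists [set u | 0 < g (u 0 0)].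
(* Mirror choice: the half-sides [1 + L - s] and [zeta s / s], the slope of the chord from the
   origin, both decrease. *)
have [|||| chi [cchi ichi]] := @nested_chart g gK [set s | 0 < s]
    (fun s => (1 + L - s) / (b - zeta s)) (fun s => s^-1).
- move=> s /= s_gt0 s01'; split; last by rewrite invr_gt0.
  by rewrite divr_gt0 ?bz//; lra.
- by apply: cbz => s; apply: cvgB; [exact: cvg_cst|exact: cvg_id].
- apply: continuous_in_subspaceT => s /set_mem[/= s_gt0 _].
  by apply: cvgV; [rewrite gt_eqF|exact: cvg_id].
- right=> s r /= s_gt0 r_gt0 s_ge0 sr rL'.
  rewrite !divfK ?gt_eqF ?bz//; try lra.
  split; first lra.
  rewrite ![_^-1 * _]mulrC ltr_pdivrMr// mulrAC ltr_pdivlMr//.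
  by have := zeta_chords (lexx 0) s_gt0 sr rL'; rewrite z0; lra.
exists chi; split => //; exact: (nz [set s | 0 < s] (lt_nbhsr s0)).
Qed.

End Chart.

(** * Self-crossing of the deformed surface *)

Section Deformation.
Variables (R : realType) (b L : R) (zeta : R -> R).
Hypothesis Hdata : fundamental_data b L zeta.

Lemma crease_derivable (c : R -> 'rV[R]_3) : crease_curve L c ->
  forall s, 0 < s < L -> derivable c s 1.
Proof.
move=> [_ _ [V [_ sV dV]] _ _] s s01.
by apply: (dV 0%N); apply: sV; rewrite /= in_itv.
Qed.

Lemma vec3_continuous (T : topologicalType) (f g h : T -> R) (x : T) :
  {for x, continuous f} -> {for x, continuous g} -> {for x, continuous h} ->
  {for x, continuous (fun y => vec3 (f y) (g y) (h y))}.
Proof.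
move=> cf cg ch.
have -> : (fun y => vec3 (f y) (g y) (h y)) = (fun y =>
    f y *: vec3 1 0 0 + g y *: vec3 0 1 0 + h y *: vec3 0 0 1 : 'rV[R]_3).
  apply/funext => y; rewrite [RHS]vec3_eta !mxE /=.
  by rewrite !mulr1 !mulr0 !addr0 !add0r.
by apply: cvgD; [apply: cvgD|]; apply: cvgZr_tmp.
Qed.

(* Near [z = 0] the sheet on [domUplus] and its mirror image under [rhoH]
   cross along the curve [s |-> (x s, 2/3 zeta s, 0)]. *)
Section Crossing.
Variables (F : R * R -> 'rV[R]_3) (x : R -> R) (w : R).
Hypotheses (Fp : forall s v, 0 < s < L -> 0 <= v <= zeta s ->
     F (s, v) = vec3 (x s) (zeta s - v / 2) (w * (v - 2 / 3 * zeta s)))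
  (w2 : w ^+ 2 = 3 / 4)
  (cx : forall s, 0 < s < L -> {for s, continuous x})
  (xinj : {in `[0, L] &, injective x}).

(** Coordinates [(s, p, q)] adapted to the crossing: the sheet is [q = - p], its mirror image is
    [q = p], and they meet along [p = q = 0]. *)
Let P (z : R * R * R) : 'rV[R]_3 :=
  vec3 (x z.1.1) (2 / 3 * zeta z.1.1 + z.1.2 / 2) (w * z.2).

Lemma crossing_continuous (s p q : R) : 0 < s < L ->
  {for (s, p, q), continuous P}.
Proof.
move=> s01.
have cs : {for (s, p, q), continuous (fun z : R * R * R => z.1.1)}.
  by apply: (@continuous_comp _ _ _ fst fst); exact: cvg_fst.
have czs : {for s, continuous zeta} by apply: (zeta_continuous Hdata); lra.
apply: vec3_continuous.
- by apply: (@continuous_comp _ _ _ (fun z : R * R * R => z.1.1) x) => //; exact: cx.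
- apply: cvgD; last first.
    apply: cvgM; last exact: cvg_cst.
    by apply: (@continuous_comp _ _ _ fst snd); [exact: cvg_fst|exact: cvg_snd].
  apply: cvgM; first exact: cvg_cst.
  by apply: (@continuous_comp _ _ _ (fun z : R * R * R => z.1.1) zeta).
- by apply: cvgM; [exact: cvg_cst|exact: cvg_snd].
Qed.

(** A small triod strip is placed in the surface around the crossing curve; a continuous injection
    [f] would carry it into the plane. *)
Lemma crossing_not_planar (s0 : R) (N : set 'rV[R]_3) (f : 'rV[R]_3 -> R * R) :
  let M := reflected_union b (F @` domU b L zeta) in
  0 < s0 < L -> within M (nbhs (P (s0, 0, 0))) N ->
  {within M `&` N, continuous f} ->
  (forall u v, M u -> N u -> M v -> N v -> f u = f v -> u = v) -> False.
Proof.
move=> M s01 nN cf finj.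
have /andP[z_gt0 _] : 0 < zeta s0 < b.
  by have [_ _ _ [_ _ _ h _]] := Hdata; exact: h.
have czs : {for s0, continuous zeta} by apply: (zeta_continuous Hdata); lra.
have /andP[s0_gt0 s0L] := s01.
have [r r0 rP] : exists2 r : R, 0 < r & forall s p q,
    `|s0 - s| < r -> `|p| < r -> `|q| < r ->
    [/\ 0 < s < L, zeta s0 / 2 < zeta s & M (P (s, p, q)) -> N (P (s, p, q))].
  have n1 : nbhs (s0, 0 : R, 0 : R) [set z : R * R * R | M (P z) -> N (P z)].
    exact: (@crossing_continuous s0 0 0 s01 _ nN).
  have n2 : nbhs s0 [set s | 0 < s < L /\ zeta s0 / 2 < zeta s].
    have h1 : nbhs s0 [set s | 0 < s] by exact: lt_nbhsr.
    have h2 : nbhs s0 [set s | s < L] by exact: lt_nbhsl.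
    have h3 : nbhs s0 [set s | zeta s0 / 2 < zeta s].
      by apply: (czs [set y | zeta s0 / 2 < y]); apply: lt_nbhsr; lra.
    by apply: filterS (filterI (filterI h1 h2) h3) => s [[/= -> ->] ?].
  move: n1 n2 => /nbhs_ballP[r1 /= r10 h1] /nbhs_ballP[r2 /= r20 h2].
  exists (Num.min r1 r2); first by rewrite lt_min r10.
  move=> s p q; rewrite !lt_min => /andP[s1 s2] /andP[p1 _] /andP[q1 _].
  have [? ?] := h2 s s2; split=> //.
  by apply: (h1 (s, p, q)); split; [split|] => //=; rewrite /ball /= sub0r normrN.
(* The bound [r / 4] keeps the strip inside the neighbourhood, as [p] and [q] are at most [2 e] in
   size. The bound [zeta s0 / 8 < zeta s / 4] keeps [v = 2/3 zeta s - p] within [[0, zeta s]]. *)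
pose e := Num.min (r / 4) (zeta s0 / 8).
have e0 : 0 < e by rewrite lt_min !divr_gt0.
have er : e <= r / 4 by rewrite ge_min lexx.
have ez : e <= zeta s0 / 8 by rewrite ge_min lexx orbT.
(* The first two legs run in opposite directions along the sheet [q = - p], the third along the
   mirror image [q = p]. *)
pose Q (z : (R * R * R) * R) : R * R * R :=
  (s0 + e * z.2, e * (z.1.1.1 - z.1.1.2 + z.1.2), e * (- z.1.1.1 + z.1.1.2 + z.1.2)).
have DQ z : triod_strip z ->
    [/\ 0 < (Q z).1.1 < L, zeta s0 / 2 < zeta (Q z).1.1 & M (P (Q z)) -> N (P (Q z))].
  move: z => [[[a a'] c'] l] /= [[a1 b1 c1 l1] _].
  by apply: rP => /=; rewrite ltr_norml; nra.
have MQ z : triod_strip z -> M (P (Q z)).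
  move=> Dz; have [+ + _] := DQ z Dz; move: z Dz.
  move=> [[[a a'] c'] l] /= [[a1 b1 c1 l1] [ab bc ca]].
  set s := s0 + e * l => s1 zs.
  have FM v : 0 <= v <= zeta s -> (F @` domU b L zeta) (F (s, v)).
    move=> v1; exists (s, v) => //; split => /=; first by lra.
    by have := @zeta_lt R b L zeta Hdata s; lra.
  have [c'0|c'0] := eqVneq c' 0.
    left; left; left.
    have v1 : 0 <= 2 / 3 * zeta s - e * (a - a') <= zeta s by nra.
    have := FM _ v1; rewrite Fp//; congr (_ _).
    by rewrite /P /= c'0; congr vec3; lra.
  have a0 : a = 0 by move/eqP: ca; rewrite mulf_eq0 (negbTE c'0) => /eqP.
  have a'0 : a' = 0 by move/eqP: bc; rewrite mulf_eq0 (negbTE c'0) orbF => /eqP.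
  have v1 : 0 <= 2 / 3 * zeta s - e * c' <= zeta s by nra.
  left; right; exists (F (s, 2 / 3 * zeta s - e * c')); first exact: FM.
  rewrite Fp// /rhoH /P /= !mxE /= a0 a'0.
  by congr vec3; lra.
have cQ : continuous Q.
  move=> z.
  have cproj (g : (R * R * R) * R -> R) : {for z, continuous g} ->
     {for z, continuous (fun y => e * g y)}.
    by move=> cg; apply: cvgM; [exact: cvg_cst|exact: cg].
  have ca : {for z, continuous (fun y : (R * R * R) * R => y.1.1.1)}.
    apply: (@continuous_comp _ _ _ fst (fun y : R * R * R => y.1.1)); first exact: cvg_fst.
    by apply: (@continuous_comp _ _ _ fst fst); exact: cvg_fst.
  have cb : {for z, continuous (fun y : (R * R * R) * R => y.1.1.2)}.
    apply: (@continuous_comp _ _ _ fst (fun y : R * R * R => y.1.2)); first exact: cvg_fst.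
    by apply: (@continuous_comp _ _ _ fst snd); [exact: cvg_fst|exact: cvg_snd].
  have cc : {for z, continuous (fun y : (R * R * R) * R => y.1.2)}.
    by apply: (@continuous_comp _ _ _ fst snd); [exact: cvg_fst|exact: cvg_snd].
  apply: (@continuous_pairfun _ _ _ _ id
    (fun y : (R * R * R) * R => (s0 + e * y.2, e * (y.1.1.1 - y.1.1.2 + y.1.2)))
    (fun y => e * (- y.1.1.1 + y.1.1.2 + y.1.2))); last exact: cvg_id.
    apply: (@continuous_pairfun _ _ _ _ id (fun y : (R * R * R) * R => s0 + e * y.2)
      (fun y => e * (y.1.1.1 - y.1.1.2 + y.1.2))); last exact: cvg_id.
      by apply: cvgD; [exact: cvg_cst|apply: cproj; exact: cvg_snd].
    by apply: cproj; apply: cvgD => //; apply: cvgB.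
  by apply: cproj; apply: cvgD => //; apply: cvgD => //; apply: cvgN.
have cPQ : {within @triod_strip R, continuous (P \o Q)}.
  apply: continuous_in_subspaceT => z /set_mem Dz.
  apply: continuous_comp; first exact: cQ.
  have [s1 _ _] := DQ z Dz; move: s1; case: (Q z) => [[s p] q] /= s1.
  exact: crossing_continuous.
apply: (@triod_strip_not_planar R (f \o (P \o Q))).
  apply: (within_comp_continuous cPQ cf) => z Dz.
  by have [_ _ NQ] := DQ z Dz; split; [exact: MQ|exact/NQ/MQ].
move=> y z Dy Dz /finj /=.
have [/= sy _ Ny] := DQ y Dy; have [/= sz _ Nz] := DQ z Dz.
move=> /(_ (MQ _ Dy) (Ny (MQ _ Dy)) (MQ _ Dz) (Nz (MQ _ Dz))) E.
have w0 : w != 0 by apply/eqP => w0; move: w2; rewrite w0; lra.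
(* Injectivity of [x] returns [s], then [p + q] returns the third leg and [p - q] the difference of
   the first two, which determines them since one of the two vanishes. *)
have {Ny Nz} sE : s0 + e * y.2 = s0 + e * z.2.
  apply: xinj; rewrite ?in_itv /=; try lra.
  by have := congr1 (fun u : 'rV[R]_3 => u 0 0) E; rewrite !mxE.
have pE : e * (y.1.1.1 - y.1.1.2 + y.1.2) = e * (z.1.1.1 - z.1.1.2 + z.1.2).
  by have := congr1 (fun u : 'rV[R]_3 => u 0 1) E; rewrite !mxE /= sE; lra.
have qE : e * (- y.1.1.1 + y.1.1.2 + y.1.2) = e * (- z.1.1.1 + z.1.1.2 + z.1.2).
  by have := congr1 (fun u : 'rV[R]_3 => u 0 2) E; rewrite !mxE => /(mulfI w0).
move: y z Dy Dz sE pE qE {E sy sz} => [[[a a'] c'] l] [[[d d'] f'] m].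
move=> /= [[a1 a1' c1 l1] [aa a'c ca]] [[d1 d1' f1 m1] [dd d'f fd]].
have en : e != 0 by rewrite gt_eqF.
move=> /addrI /(mulfI en) <- /(mulfI en) pE /(mulfI en) qE.
have <- : c' = f' by lra.
have E : a - a' = d - d' by lra.
have [<- <-] : a = d /\ a' = d'.
  move/eqP: aa; rewrite mulf_eq0 => /orP[]/eqP h;
  by move/eqP: dd; rewrite mulf_eq0 => /orP[]/eqP h'; lra.
by [].
Qed.

End Crossing.

End Deformation.

(** * Choice of the folded parameter and conclusion *)

Section Main.
Variables (R : realType) (b L : R) (zeta : R -> R).
Hypothesis Hdata : fundamental_data b L zeta.

(** With [eta_y = -1/2] the relations of [crease_sheet] give [eta_z^2 = 3/4] and
    [c_z = - 2/3 eta_z zeta], so the upper sheet crosses [z = 0] at [v = 2/3 zeta]. A homeomorphism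
    to the box followed by a local chart would inject a neighbourhood of the crossing into the
    plane. *)
Lemma folded_not_box (F : R * R -> 'rV[R]_3) (c xi : R -> 'rV[R]_3) (s0 : R) :
  origami_map b L zeta F c xi (fun=> xi_check R) ->
  first_form_is_g L zeta (domUplus b L zeta) (ruled c xi) ->
  first_form_is_g L zeta (domUminus b L zeta) (ruled c (fun=> xi_check R)) ->
  on_x_axis (c 0) -> on_x_axis (c L) ->
  {within `[0, L], continuous (fun s => pillow_curve zeta s 0 0)} ->
  {in `[0, L] &, injective (fun s => pillow_curve zeta s 0 0)} ->
  0 < s0 < L -> xi s0 0 1 = - 2^-1 ->
  ~ homeomorphic (reflected_union b (F @` domU b L zeta)) (pillow_box b L zeta).
Proof.
move=> [_ cr Fp _ _] ffp ffm ax0 axL cx0 x0inj s01 xi01 [f [cf [fM finj _] _]].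
have dc := crease_derivable cr; have [cc cinj _ _ _] := cr.
have [eta [xiE e0 e12 ez]] := crease_sheet Hdata cc cinj dc ffp ffm ax0 axL.
have e1 : eta 0 1 = - 2^-1 by rewrite -(xiE s0).
have w2 : eta 0 2 ^+ 2 = 3 / 4 by move: e12; rewrite e1; lra.
have cE s : 0 <= s <= L -> c s 0 1 = zeta s /\ c s 0 2 = (- (2 / 3) * eta 0 2) * zeta s.
  move=> s1; split; first exact: (crease_height Hdata cc dc ffm ax0 s1).
  have E : c s 0 2 * eta 0 2 ^+ 2 = - 2^-1 * eta 0 2 * zeta s.
    have := congr1 (fun y => eta 0 2 * y) (ez s s1); rewrite e1 mulr0 => E.
    by lra.
  by move: E; rewrite w2; lra.
have FE s v : 0 < s < L -> 0 <= v <= zeta s ->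
    F (s, v) = vec3 (c s 0 0) (zeta s - v / 2) (eta 0 2 * (v - 2 / 3 * zeta s)).
  move=> s1 v1; have s1' : 0 <= s <= L by lra.
  rewrite Fp; last exact: (domUplusP Hdata s1' v1).
  rewrite /ruled /= xiE// [LHS]vec3_eta !mxE e0 e1 (cE s s1').1 (cE s s1').2.
  by congr vec3; lra.
have xinj : {in `[0, L] &, injective (fun s => c s 0 0)}.
  apply: (@crease_x_inj _ _ _ _ Hdata c (- (2 / 3) * eta 0 2)) => //.
    by rewrite exprMn w2; lra.
  by move=> s s1; have [] := ruling_derive0 Hdata s1 (dc s s1) ffp.
have cx s : 0 < s < L -> {for s, continuous (fun s => c s 0 0)}.
  move=> s1; apply/differentiable_continuous/derivable1_diffP.
  exact: (iffLR (derivable_mxP _ _ _) (dc s s1)).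
set M := reflected_union _ _ in cf fM finj *.
(* The unsimplified zeros match the value at [(s0, 0, 0)] of the crossing coordinates. *)
pose p0 : 'rV[R]_3 := vec3 (c s0 0 0) (2 / 3 * zeta s0 + 0 / 2) (eta 0 2 * 0).
have /andP[z_gt0 _] : 0 < zeta s0 < b.
  by have [_ _ _ [_ _ _ h _]] := Hdata; exact: h.
have Mp0 : M p0.
  left; left; left; exists (s0, 2 / 3 * zeta s0).
    split=> /=; first by lra.
    by have := @zeta_lt R b L zeta Hdata s0; lra.
  rewrite FE//; last by lra.
  by rewrite /p0; congr vec3; lra.
have [N [chi [nN cchi ichi]]] :=
  pillow_box_local_chart Hdata cx0 x0inj (fM _ Mp0).
have nfN : within M (nbhs p0) (f @^-1` N).
  have : within M (nbhs p0) (f @^-1` [set u | pillow_box b L zeta u -> N u]).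
    by rewrite nbhs_subspace_in//; exact: cf.
  apply: filter_app; apply: filterS (withinT _ (nbhs_filter p0)) => y My /=.
  by apply; exact: fM.
apply: (@crossing_not_planar R b L zeta Hdata F (fun s => c s 0 0) (eta 0 2)
  FE w2 cx xinj s0 (f @^-1` N) (chi \o f) s01 nfN).
  apply: (@within_comp_continuous _ _ _ _ (pillow_box b L zeta `&` N)) => //.
    by apply: continuous_subspaceW cf => u [].
  by move=> u [Mu Nu]; split=> //; exact: fM.
move=> u v Mu Nu Mv Nv /= E; apply: finj; rewrite ?inE//.
by apply: ichi => //; exact: fM.
Qed.

(** At time 0 the crease is [pillow_curve], so continuity and injectivity of the integral in its
    first coordinate follow from the regularity and unit speed of the crease, with [lam = 1]. *)
Lemma pillow_curve_x (F : R * R -> 'rV[R]_3) (c xi : R -> 'rV[R]_3) :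
  origami_map b L zeta F c xi (fun=> xi_check R) ->
  first_form_is_g L zeta (domUplus b L zeta) (ruled c xi) ->
  (forall x, domU b L zeta x -> F x = origami_param zeta x) ->
  {within `[0, L], continuous (fun s => pillow_curve zeta s 0 0)} /\
  {in `[0, L] &, injective (fun s => pillow_curve zeta s 0 0)}.
Proof.
move=> [_ cr Fp _ _] ffp FE.
have dc := crease_derivable cr; have [cc _ _ _ _] := cr.
have cE s : 0 <= s <= L -> c s = pillow_curve zeta s.
  move=> s1; have z1 : 0 <= (0 : R) <= zeta s.
    by rewrite lexx /=; have /andP[] := zeta_lt Hdata s1.
  have U := domUplusP Hdata s1 z1.
  have := Fp _ U; rewrite FE; last by case: U.
  by rewrite /origami_param /ruled /= lexx !scale0r !addr0.
split.
  apply: (@subspace_eq_continuous _ _ _ (fun s => c s 0 0)).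
    by move=> s /set_mem /=; rewrite in_itv /= => /cE ->.
  exact: coord_within.
have cinj : {in `[0, L] &, injective (fun s => c s 0 0)}.
  apply: (@crease_x_inj _ _ _ _ Hdata c 1) => //.
  - by move=> s s1; have [] := ruling_derive0 Hdata s1 (dc s s1) ffp.
  - by move=> s s1; rewrite cE// !mxE /= mul1r.
move=> s r s1 r1; rewrite -!cE; first exact: cinj.
  by move: r1; rewrite in_itv.
by move: s1; rewrite in_itv.
Qed.

End Main.

Unset Implicit Arguments.

Theorem corollary4p9 (R : realType) (b L : R) (zeta : R -> R)
    (Hdata : fundamental_data b L zeta)
    (M : R -> set 'rV[R]_3)
    (HM : origami_deformation b L zeta M) :
  exists t : R, 0 < t < 1 /\ ~ homeomorphic (M t) (pillow_box b L zeta).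
Proof.
have [b0 L0 _ [_ z0 zL zb _]] := Hdata.
have [X [[cX [c [xi [orig X0 X1 ff ax]]]] MX]] := HM.
pose s0 := L / 2.
have s01 : 0 < s0 < L by rewrite /s0; lra.
have /andP[z_gt0 zltb] := zb _ s01.
have Us v : 0 <= v <= zeta s0 -> domUplus b L zeta (s0, v).
  by apply: domUplusP => //; lra.
have cXv v : 0 <= v <= zeta s0 -> {within `[0, 1], continuous (fun t => X t (s0, v) 0 1)}.
  move=> v01; apply: (coord_within (c := fun t => X t (s0, v))).
  have cpair : {within `[0, 1], continuous (fun t : R => (t, (s0, v)))}.
    apply: continuous_subspaceT => t.
    by apply: (@continuous_pairfun _ _ _ _ id); [exact: cvg_id|exact: cvg_cst|exact: cvg_id].
  apply: (within_comp_continuous cpair cX) => t /=; rewrite in_itv => t01.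
  by split=> //; have [] := Us v v01.
have zz : 0 <= zeta s0 <= zeta s0 by rewrite lexx ltW.
have z00 : 0 <= (0 : R) <= zeta s0 by rewrite lexx ltW.
(* Continuity in [t] is given for [X] only, so the y-component of the ruling is read off from two
   points of one ruling segment. *)
pose g t := X t (s0, zeta s0) 0 1 - X t (s0, 0) 0 1.
have gE t : 0 <= t <= 1 -> g t = zeta s0 * xi t s0 0 1.
  move=> /orig[_ _ Fp _ _]; rewrite /g !Fp; try exact: Us.
  by rewrite /ruled /= !mxE; ring.
have g0 : g 0 = 0.
  rewrite /g !X0; [|by case: (Us _ z00)|by case: (Us _ zz)].
  by rewrite /origami_param /= lexx ltW//= !mxE /=; ring.
have g1 : g 1 = - zeta s0.
  rewrite /g !X1; [|by case: (Us _ z00)|by case: (Us _ zz)].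
  by rewrite /developing_map /= !mxE /=; ring.
(* The rulings [(0, 0, -1)] at [t = 0] and [(0, -1, 0)] at [t = 1] give [g] the values [0] and
   [- zeta s0]; the intermediate value chosen corresponds to [xi_y = -1/2]. *)
have [||t] := @IVT R g 0 1 (- (zeta s0 / 2)) ler01.
- by move=> t; apply: cvgB; exact: cXv.
- by rewrite g0 g1 ge_min le_max; apply/andP; split; apply/orP; [right|left]; lra.
rewrite in_itv /= => t01 gt.
have tn0 : t != 0 by apply/eqP => tE; move: gt; rewrite tE g0; lra.
have tn1 : t != 1 by apply/eqP => tE; move: gt; rewrite tE g1; lra.
exists t; split.
  by have /andP[t0 t1] := t01; rewrite lt_neqAle eq_sym tn0 t0 lt_neqAle tn1.
rewrite MX//.
have h01 : 0 <= (0 : R) <= 1 by rewrite lexx ler01.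
have [cx0 x0inj] := pillow_curve_x Hdata (orig 0 h01) (ff 0 h01).1 X0.
apply: (folded_not_box Hdata (orig t t01) (ff t t01).1 (ff t t01).2
  (ax t t01).1 (ax t t01).2 cx0 x0inj s01).
apply: (@mulfI _ (zeta s0)); first by rewrite gt_eqF.
by rewrite -gE// gt mulrN.
Qed.
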